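(* Let $X$, $Y$ be normed spaces and $E$ an order complete normed lattice, let $\Omega\subset X$ be open, and let $H$ be a nonempty set of functions $h\colon X\to\overline{E}$. Suppose that: (1) a function $F\colon\Omega\to E$ is strongly $H$-codifferentiable at a point $x\in\Omega$; (2) the strong $H$-derivative $F'_H[x]$ is Lipschitz continuous in a neighbourhood of zero; (3) $S\subset Y$ is an open set and $y\in S$; (4) a function $G\colon S\to X$ is continuous and G\^ateaux differentiable at the point $y$ (with G\^ateaux derivative $\delta G[y]$), and $G(y)=x$. Then there exists an open set $\mathcal{O}\subset S$ with $y\in\mathcal{O}$ such that the function $T=F\circ G$ is defined on $\mathcal{O}$ and is weakly $\widehat{H}$-codifferentiable at $y$, where $$\widehat{H}=\{\hat h\colon Y\to\overline{E}\mid \hat h=h\circ\delta G[y],\ h\in H\}.$$ Moreover, for any $(\Phi,\Psi)\in F'_H[x]$ and any $(U,V)\in D^s_HF(x)$ one has $$\delta T_{\widehat H}[y]=[\Phi\circ\delta G[y],\Psi\circ\delta G[y]]_w,$$ $$D^w_{\widehat H}T(y)=\Big[\{h\circ\delta G[y]\mid h\in U\},\{p\circ\delta G[y]\mid p\in V\}\Big]_w.$$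
   Context: $\overline{E}=E\cup\{-\infty,+\infty\}$ with the improper elements as least and greatest elements. The usual rules $x+(\pm\infty)=\pm\infty$ for $x\in E$ apply; expressions $+\infty+(-\infty)$ are not considered (all sums are understood to be well defined). For a function $f$ with values in $\overline E$, $\operatorname{dom}f$ is the set of points where $f$ takes values in $E$. $\delta G[y]$ is a bounded linear operator $Y\to X$. Let $Z$ be a normed space and $K$ a nonempty set of functions $Z\to\overline E$. A function is $K$-convex (resp. $K$-concave) if it is the pointwise supremum (resp. infimum) of a nonempty subset of $K$; it is then said to be generated by that subset. $PF(Z,\overline E,K)$ is the set of pairs $(\Phi,\Psi)$ with $\Phi\colon Z\to\overline E$ $K$-convex, $\Psi\colon Z\to\overline E$ $K$-concave, and $\operatorname{dom}\Phi\cap\operatorname{dom}\Psi$ containing a neighbourhood of $0$. On this set, $(\Phi_1,\Psi_1)\,\sigma_w\,(\Phi_2,\Psi_2)$ means that $\Phi_1(0)+\Psi_1(0)=\Phi_2(0)+\Psi_2(0)$ and for every $z\in Z$, $\frac1\alpha(\Phi_1(\alpha z)+\Psi_1(\alpha z)-\Phi_2(\alpha z)-\Psi_2(\alpha z))\to0$ as $\alpha\downarrow0$; and $(\Phi_1,\Psi_1)\,\sigma_s\,(\Phi_2,\Psi_2)$ means that the values at $0$ of the two sums agree and $\frac1{\|z\|}(\Phi_1(z)+\Psi_1(z)-\Phi_2(z)-\Psi_2(z))\to0$ as $z\to0$. Equivalence classes are denoted $[\Phi,\Psi]_w$, $[\Phi,\Psi]_s$. For pairs $(U,V)$ of nonempty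 subsets of $K$ such that $(\sup_{h\in U}h,\inf_{p\in V}p)\in PF(Z,\overline E,K)$, the classes $[U,V]_w$, $[U,V]_s$ are the equivalence classes under the relations ''the associated pairs $(\sup_Uh,\inf_Vp)$ are $\sigma_w$-equivalent'' (resp. $\sigma_s$-equivalent). Let $W\subset Z$ be open and $f\colon W\to E$. Given $(\Phi,\Psi)$, an increment $\Delta z\in Z$ is admissible if the segment $\operatorname{co}\{z,z+\Delta z\}\subset W$ and $\operatorname{co}\{0,\Delta z\}\subset\operatorname{dom}\Phi\cap\operatorname{dom}\Psi$. The function $f$ is weakly $K$-codifferentiable at $z\in W$ if there is $(\Phi,\Psi)\in PF(Z,\overline E,K)$ with $\Phi(0)+\Psi(0)=0$ and $f(z+\Delta z)-f(z)=\Phi(\Delta z)+\Psi(\Delta z)+o(\Delta z,z)$ for every admissible $\Delta z$, where $o(\alpha\Delta z,z)/\alpha\to0$ as $\alpha\downarrow0$; the (unique) class $\delta f_K[z]=[\Phi,\Psi]_w$ is the weak $K$-derivative. It is strongly $K$-codifferentiable at $z$ if the same holds with $o(\Delta z,z)/\|\Delta z\|\to0$ as $\Delta z\to0$; the class $f'_K[z]=[\Phi,\Psi]_s$ is the strong $K$-derivative. If $\Phi$ is generated by $U\subset K$ and $\Psi$ by $V\subset K$, where $(\Phi,\Psi)\in\delta f_K[z]$ (resp. $f'_K[z]$), then $D^w_Kf(z)=[U,V]_w$ (resp. $D^s_Kf(z)=[U,V]_s$) is the weak (resp. strong) $K$-codifferential; it does not depend on the choices. $F'_H[x]$ is Lipschitz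 continuous in a neighbourhood of zero if there exists $(\Phi,\Psi)\in F'_H[x]$ such that $\Phi$ and $\Psi$ are Lipschitz continuous in a neighbourhood of zero. *)

(* Defs.v *)
From HB Require Import structures.
From mathcomp Require Import all_boot all_order all_algebra.
From mathcomp Require Import all_classical all_reals all_analysis.

Set Implicit Arguments.
Unset Strict Implicit.
Unset Printing Implicit Defensive.

Import Order.TTheory GRing.Theory Num.Theory.
Import numFieldNormedType.Exports.

Local Open Scope classical_set_scope.
Local Open Scope ring_scope.

(* The order is a field of the structure, not an instance of [Order.POrder]:
   Hierarchy Builder does not accept a join of [NormedModule] and [Order.POrder]
   declared after [Num.NumDomain], which inherits from both. *)
HB.mixin Record isNormedLattice (R : realType) E of NormedModule R E := {
  nlat_le : rel E ;
  nlat_join : E -> E -> E ;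
  nlat_meet : E -> E -> E ;
  nlat_le_refl : reflexive nlat_le ;
  nlat_le_anti : antisymmetric nlat_le ;
  nlat_le_trans : transitive nlat_le ;
  nlat_leUx : forall x y z : E,
    nlat_le (nlat_join x y) z = nlat_le x z && nlat_le y z ;
  nlat_lexI : forall x y z : E,
    nlat_le z (nlat_meet x y) = nlat_le z x && nlat_le z y ;
  nlat_leD2r : forall z x y : E, nlat_le x y -> nlat_le (x + z) (y + z) ;
  nlat_leZ : forall (a : R) (x y : E),
    0 <= a -> nlat_le x y -> nlat_le (a *: x) (a *: y) ;
  nlat_le_norm : forall x y : E,
    nlat_le (nlat_join x (- x)) (nlat_join y (- y)) -> `|x| <= `|y|
}.

#[short(type="normedLatticeType")]
HB.structure Definition NormedLattice (R : realType) :=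
  { E of NormedModule R E & isNormedLattice R E }.

Definition order_complete (R : realType) (E : normedLatticeType R) : Prop :=
  forall A : set E, A !=set0 ->
    (exists b, forall x, A x -> nlat_le x b) ->
    exists s, (forall x, A x -> nlat_le x s) /\
              (forall b, (forall x, A x -> nlat_le x b) -> nlat_le s b).

(* [xlat E] is [\bar E] ordered by the order of [E], with [-oo] as least and
   [+oo] as greatest element; the library orders [\bar E] only when [E] is a
   [numDomainType]. *)
Definition xlat (R : realType) (E : normedLatticeType R) : Type := \bar E.

Section ExtendedOrder.
Context {R : realType} {E : normedLatticeType R}.

HB.instance Definition _ := Choice.on (xlat E).

Definition xlat_le (a b : xlat E) : bool :=
  match a, b with
  | -oo%E, _ | _, +oo%E => true
  | EFin u, EFin v => nlat_le u v
  | _, _ => false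
  end.

Let xlat_lt (a b : xlat E) : bool := (b != a) && xlat_le a b.

Let xlat_lt_def a b : xlat_lt a b = (b != a) && xlat_le a b.
Proof. by []. Qed.

Let xlat_le_refl : reflexive xlat_le.
Proof. by case=> //= u; exact: nlat_le_refl. Qed.

Let xlat_le_anti : antisymmetric xlat_le.
Proof. by move=> [u||] [v||] //= /nlat_le_anti ->. Qed.

Let xlat_le_trans : transitive xlat_le.
Proof. by move=> [u||] [v||] [w||] //=; exact: nlat_le_trans. Qed.

HB.instance Definition _ := Order.isPOrder.Build ereal_display (xlat E)
  xlat_lt_def xlat_le_refl xlat_le_anti xlat_le_trans.

End ExtendedOrder.

Section Codifferentiability.
Context {R : realType} {Z : normedModType R} {E : normedLatticeType R}.

Implicit Types (K U V : set (Z -> \bar E)) (W : set Z) (f : Z -> E) (z : Z).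
Implicit Types (Phi Psi : Z -> \bar E).
Implicit Types (p q : (Z -> \bar E) * (Z -> \bar E)).
Implicit Types (P Q : set (Z -> \bar E) * set (Z -> \bar E)).

Definition psup U : Z -> \bar E :=
  fun z => supremum (-oo%E : xlat E) [set h z | h in U].

Definition pinf V : Z -> \bar E :=
  fun z => infimum (+oo%E : xlat E) [set h z | h in V].

Definition generated_sup K U Phi := [/\ U !=set0, U `<=` K & Phi = psup U].

Definition generated_inf K V Psi := [/\ V !=set0, V `<=` K & Psi = pinf V].

Definition Kconvex K Phi := exists U, generated_sup K U Phi.

Definition Kconcave K Psi := exists V, generated_inf K V Psi.

Definition edom Phi : set Z := Phi @^-1` range (@EFin E).

Definition PF K : set ((Z -> \bar E) * (Z -> \bar E)) :=
  [set p | [/\ Kconvex K p.1, Kconcave K p.2 & nbhs 0 (edom p.1 `&` edom p.2)]].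

(* In the two relations below [fine] is applied to an element of [E] as soon as
   its argument is close to [0], if [p] and [q] are in [PF K]. *)
Definition sigma_w p q : Prop :=
  (p.1 0%R + p.2 0%R = q.1 0%R + q.2 0%R)%E /\
  forall z : Z,
    (fun a : R => a^-1 *: fine (p.1 (a *: z) + p.2 (a *: z)
                                - q.1 (a *: z) - q.2 (a *: z))%E)
      @ 0^'+ --> (0 : E).

Definition sigma_s p q : Prop :=
  (p.1 0%R + p.2 0%R = q.1 0%R + q.2 0%R)%E /\
  (fun z : Z => `|z|^-1 *: fine (p.1 z + p.2 z - q.1 z - q.2 z)%E)
    @ 0^' --> (0 : E).

Definition class_w K p := [set q | [/\ PF K p, PF K q & sigma_w p q]].

Definition class_s K p := [set q | [/\ PF K p, PF K q & sigma_s p q]].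

Definition generated_pair P := (psup P.1, pinf P.2).

Definition PFgen K : set (set (Z -> \bar E) * set (Z -> \bar E)) :=
  [set P | [/\ P.1 !=set0, P.1 `<=` K, P.2 !=set0, P.2 `<=` K &
               PF K (generated_pair P)]].

Definition gen_class_w K P := [set Q | [/\ PFgen K P, PFgen K Q &
  sigma_w (generated_pair P) (generated_pair Q)]].

Definition gen_class_s K P := [set Q | [/\ PFgen K P, PFgen K Q &
  sigma_s (generated_pair P) (generated_pair Q)]].

Definition segment (a b : Z) : set Z :=
  [set (1 - t) *: a + t *: b | t in `[0%R, 1%R]%classic].

Definition admissible W z p (dz : Z) : Prop :=
  segment z (z + dz) `<=` W /\ segment 0 dz `<=` edom p.1 `&` edom p.2.

(* A function [W -> E] is represented by a function [f : Z -> E], whose values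
   outside [W] are not used when [W z]. *)
Definition weak_expansion K W f z p : Prop :=
  [/\ PF K p, (p.1 0%R + p.2 0%R = 0)%E &
    exists o : Z -> E, forall dz : Z, admissible W z p dz ->
      (f (z + dz) - f z)%:E = (p.1 dz + p.2 dz + (o dz)%:E)%E /\
      (fun a : R => a^-1 *: o (a *: dz)) @ 0^'+ --> (0 : E)].

Definition strong_expansion K W f z p : Prop :=
  [/\ PF K p, (p.1 0%R + p.2 0%R = 0)%E &
    exists o : Z -> E, (forall dz : Z, admissible W z p dz ->
      (f (z + dz) - f z)%:E = (p.1 dz + p.2 dz + (o dz)%:E)%E) /\
      (fun dz : Z => `|dz|^-1 *: o dz) @ 0^' --> (0 : E)].

Definition weakly_codifferentiable K W f z :=
  exists p, weak_expansion K W f z p.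

Definition strongly_codifferentiable K W f z :=
  exists p, strong_expansion K W f z p.

(* The four notions below are definite descriptions ([get]): the set described
   is a singleton when [f] is codifferentiable at a point [z] of the open set
   [W]. *)
Definition weak_derivative K W f z : set ((Z -> \bar E) * (Z -> \bar E)) :=
  get [set C | exists2 p, weak_expansion K W f z p & C = class_w K p].

Definition strong_derivative K W f z : set ((Z -> \bar E) * (Z -> \bar E)) :=
  get [set C | exists2 p, strong_expansion K W f z p & C = class_s K p].

Definition weak_codifferential K W f z :
    set (set (Z -> \bar E) * set (Z -> \bar E)) :=
  get [set D | exists p P, [/\ weak_derivative K W f z p,
    generated_sup K P.1 p.1, generated_inf K P.2 p.2 & D = gen_class_w K P]].

Definition strong_codifferential K W f z :
    set (set (Z -> \bar E) * set (Z -> \bar E)) :=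
  get [set D | exists p P, [/\ strong_derivative K W f z p,
    generated_sup K P.1 p.1, generated_inf K P.2 p.2 & D = gen_class_s K P]].

Definition lipschitz_near0 Phi : Prop :=
  exists (k : R) (N : set Z),
    [/\ nbhs 0 N, N `<=` edom Phi & k.-lipschitz_N (fine \o Phi)].

Definition class_lipschitz_near0 (C : set ((Z -> \bar E) * (Z -> \bar E))) :=
  exists p, [/\ C p, lipschitz_near0 p.1 & lipschitz_near0 p.2].

End Codifferentiability.

Definition is_gateaux_derivative (R : realType) (Y X : normedModType R)
    (G : Y -> X) (y : Y) (dG : {linear Y -> X}) : Prop :=
  bounded_near dG (nbhs 0) /\ forall h : Y, is_derive y h G (dG h).

Definition precomp_set (X Y T : Type) (H : set (X -> T)) (L : Y -> X) :
    set (Y -> T) := [set h \o L | h in H].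

(* Main.v *)
Require Import Defs.
From HB Require Import structures.
From mathcomp Require Import all_boot all_order all_algebra.
From mathcomp Require Import all_classical all_reals all_analysis.
Import Order.TTheory GRing.Theory Num.Theory.
Import numFieldNormedType.Exports.
Local Open Scope classical_set_scope.
Local Open Scope ring_scope.

(* Near 0 the two members of a pair (Phi, Psi) are finite, so the expansions and
   the relations sigma_w, sigma_s only say that the value of Phi + Psi at 0 is
   prescribed and that a remainder is little-o, along rays or uniformly.

   Put k a = G (y + a h) - G y = a dG h + o(a) and let (Phi, Psi) be Lipschitz
   near 0.  The strong expansion of F at x gives
   F (G (y + a h)) - F x = (Phi + Psi) (k a) + o(|k a|), where o(|k a|) = o(a),
   and the Lipschitz property gives
   (Phi + Psi) (k a) - (Phi + Psi) (a dG h) = o(a).  Any other pair of F'_H[x]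
   differs from this one by a strong little-o, hence, composed with dG, by a
   little-o along rays. *)

(** * Little-o remainders, along rays and in norm *)

Section LittleO.
Context {R : realType} {Z E : normedModType R}.
Implicit Types (g h : Z -> E) (z : Z).

Definition weak_o g : Prop :=
  forall z, (fun a : R => a^-1 *: g (a *: z)) @ 0^'+ --> (0 : E).

Definition strong_o g : Prop :=
  (fun z => `|z|^-1 *: g z) @ 0^' --> (0 : E).

Lemma weak_oN g : weak_o g -> weak_o (fun z => - g z).
Proof.
move=> go z; rewrite -(oppr0 E).
by under eq_fun do rewrite scalerN; exact: cvgN (go z).
Qed.

Lemma strong_oN g : strong_o g -> strong_o (fun z => - g z).
Proof.
move=> go; rewrite /strong_o -(oppr0 E).
by under eq_fun do rewrite scalerN; exact: cvgN go.
Qed.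

Lemma weak_oB g h : weak_o g -> weak_o h -> weak_o (fun z => g z - h z).
Proof.
move=> go ho z; rewrite -(subr0 (0 : E)).
under eq_fun do rewrite scalerBr.
exact: cvgB (go z) (ho z).
Qed.

Lemma strong_oB g h : strong_o g -> strong_o h -> strong_o (fun z => g z - h z).
Proof.
move=> go ho; rewrite /strong_o -(subr0 (0 : E)).
under eq_fun do rewrite scalerBr.
exact: cvgB go ho.
Qed.

Lemma cvg_scale_right z : (fun a : R => a *: z) @ 0^'+ --> (0 : Z).
Proof.
rewrite -(scale0r z); apply: cvgZr_tmp.
by apply: cvg_at_right_filter; exact: cvg_id.
Qed.

Lemma near_scale_right z (A : Z -> Prop) :
  (\forall u \near 0, A u) -> \forall a \near (0 : R)^'+, A (a *: z).
Proof. exact: cvg_scale_right. Qed.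

(** The curve is [a] times its rate, hence a product of something tending to 0 and something tending
    to [v]. *)
Lemma rate_cvg0 (k : R -> Z) (v : Z) :
  (fun a : R => a^-1 *: k a) @ 0^'+ --> v -> k @ 0^'+ --> (0 : Z).
Proof.
move=> kv.
have id0 : (fun a : R => a) @ 0^'+ --> (0 : R).
  by apply: cvg_at_right_filter; exact: cvg_id.
rewrite -(scale0r v).
apply: cvg_trans (cvgZ id0 kv); apply: near_eq_cvg; near=> a.
by rewrite scalerA divff ?scale1r.
Unshelve. all: by end_near. Qed.

(* [g 0 = 0] is needed because [strong_o] says nothing about [g] at [0], a value
   that the curve [k] may take for arbitrarily small [a]. *)
Lemma strong_o_curve g (k : R -> Z) (v : Z) :
  strong_o g -> g 0 = 0 -> (fun a : R => a^-1 *: k a) @ 0^'+ --> v ->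
  (fun a : R => a^-1 *: g (k a)) @ 0^'+ --> (0 : E).
Proof.
move=> go g0 kv.
have k0 := rate_cvg0 _ _ kv.
apply/cvgr0Pnorm_le => e e0.
(* [|v| + 1] bounds the norm of the rate [a^-1 *: k a] for small [a], and it is positive even if [v]
   is zero, so [e] may be divided by it. *)
have M0 : 0 < `|v| + 1 by rewrite ltr_wpDl.
have /= := cvgr0_norm_le _ go (e / (`|v| + 1)) (divr_gt0 e0 M0).
rewrite near_withinE => /(_ _)/k0 gz.
have gk : \forall a \near 0^'+,
    k a != 0 -> `| `|k a|^-1 *: g (k a)| <= e / (`|v| + 1) by exact: gz.
have kM : \forall a \near 0^'+, `|a^-1 *: k a| <= `|v| + 1.
  by apply: (cvgr_norm_le _ kv); rewrite ltrDl.
near=> a.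
have a0 : 0 < a by [].
have [->|ka0] := eqVneq (k a) 0; first by rewrite g0 scaler0 normr0 ltW.
have gka : `| `|k a|^-1 *: g (k a)| <= e / (`|v| + 1).
  by apply: (near gk a).
have -> : a^-1 *: g (k a) = `|a^-1 *: k a| *: (`|k a|^-1 *: g (k a)).
  by rewrite scalerA normrZ gtr0_norm ?invr_gt0// mulfK// normr_eq0.
rewrite normrZ normr_id mulrC -[leRHS](divfK (lt0r_neq0 M0)).
by apply: ler_pM => //; near: a.
Unshelve. all: by end_near. Qed.

(** A ray is a curve whose rate is constantly [z]. *)
Lemma strong_o_weak g : strong_o g -> g 0 = 0 -> weak_o g.
Proof.
move=> go g0 z; apply: (strong_o_curve _ _ z go g0).
apply: cvg_trans (@cvg_cst _ z _ (0^'+ : set_system R) _); apply: near_eq_cvg.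
by near=> a; rewrite scalerA mulVf ?scale1r.
Unshelve. all: by end_near. Qed.

End LittleO.

(** * Finite values near the origin and remainders of expansions *)

Section Codifferentiability.
Context {R : realType} {Z : normedModType R} {E : normedLatticeType R}.
Implicit Types (K U V : set (Z -> \bar E)) (W : set Z) (f : Z -> E) (z : Z).
Implicit Types (p q r : (Z -> \bar E) * (Z -> \bar E)).
Implicit Types (P Q : set (Z -> \bar E) * set (Z -> \bar E)).

(** [fine] sends infinite values to 0, so this is a total function into [E]; it represents the sum
    of the pair where both members are finite. *)
Definition pair_val p z : E := fine (p.1 z) + fine (p.2 z).

Lemma edom_sumE p z : (edom p.1 `&` edom p.2) z ->
  (p.1 z + p.2 z)%E = (pair_val p z)%:E.
Proof. by rewrite /pair_val => -[[u _ <-] [v _ <-]]. Qed.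

Lemma edom_subE p q z :
  (edom p.1 `&` edom p.2) z -> (edom q.1 `&` edom q.2) z ->
  fine (p.1 z + p.2 z - q.1 z - q.2 z)%E = pair_val p z - pair_val q z.
Proof.
rewrite /pair_val => -[[u _ <-] [v _ <-]] [[s _ <-] [t _ <-]] /=.
by rewrite opprD addrA.
Qed.

Lemma PF_edom0 {K p} : PF K p -> (edom p.1 `&` edom p.2) 0.
Proof. by case=> _ _ /nbhs_singleton. Qed.

Lemma PF_sum_eq0 K p : PF K p ->
  (p.1 0%R + p.2 0%R = 0)%E <-> pair_val p 0 = 0.
Proof.
move=> /PF_edom0/edom_sumE ->; split=> [[]//|-> //].
Qed.

Lemma PF_sum_eq K p q : PF K p -> PF K q ->
  (p.1 0%R + p.2 0%R = q.1 0%R + q.2 0%R)%E <-> pair_val p 0 = pair_val q 0.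
Proof.
move=> /PF_edom0/edom_sumE -> /PF_edom0/edom_sumE ->; split=> [[]//|-> //].
Qed.

(** Limits at 0 see only values close to 0, where membership in [PF] makes all four functions
    finite. *)
Lemma near_fine_sub {K p q} : PF K p -> PF K q -> \forall z \near (0 : Z),
  fine (p.1 z + p.2 z - q.1 z - q.2 z)%E = pair_val p z - pair_val q z.
Proof.
move=> [_ _ np] [_ _ nq]; near=> z.
by apply: edom_subE; near: z.
Unshelve. all: by end_near. Qed.

Lemma sigma_wP K p q : PF K p -> PF K q -> sigma_w p q <->
  pair_val p 0 = pair_val q 0 /\
  weak_o (fun z => pair_val p z - pair_val q z).
Proof.
move=> Pp Pq; rewrite /sigma_w (PF_sum_eq _ _ _ Pp Pq).
have npq z := near_scale_right z _ (near_fine_sub Pp Pq).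
split=> -[pq0 lim]; split=> // z; apply: cvg_trans (lim z);
  apply: near_eq_cvg; near=> a; congr (_ *: _); [|symmetry];
  exact: (near (npq z) a).
Unshelve. all: by end_near. Qed.

Lemma sigma_sP K p q : PF K p -> PF K q -> sigma_s p q <->
  pair_val p 0 = pair_val q 0 /\
  strong_o (fun z => pair_val p z - pair_val q z).
Proof.
move=> Pp Pq; rewrite /sigma_s (PF_sum_eq _ _ _ Pp Pq).
have npq := nbhs_dnbhs (near_fine_sub Pp Pq).
split=> -[pq0 lim]; split=> //; apply: cvg_trans lim;
  apply: near_eq_cvg; near=> z; congr (_ *: _); [|symmetry];
  exact: (near npq z).
Unshelve. all: by end_near. Qed.

(** A ball contains the segments from its centre to its points, so a bound on the norm of [dz] keeps
    both segments inside balls around [z] and 0. *)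
Lemma near_admissible {K W z p} : open W -> W z -> PF K p ->
  \forall dz \near (0 : Z), admissible W z p dz.
Proof.
move=> oW Wz [_ _ np].
have /nbhs_ballP[d /= d0 dW] := open_nbhs_nbhs (conj oW Wz).
have /nbhs_ballP[e /= e0 ep] := np.
near=> dz.
have dzd : `|dz| < d by near: dz; exact: nbhs0_lt.
have dze : `|dz| < e by near: dz; exact: nbhs0_lt.
have le_tdz (t : R) : `[0, 1]%classic t -> `|t *: dz| <= `|dz|.
  rewrite /= in_itv /= => /andP[t0 t1].
  by rewrite normrZ ger0_norm// ler_piMl.
split=> [_|_] [t /le_tdz tdz <-].
- apply: dW; rewrite -ball_normE /=.
  rewrite scalerDr addrA -scalerDl subrK scale1r opprD addrA subrr sub0r normrN.
  exact: le_lt_trans tdz dzd.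
- apply: ep; rewrite -ball_normE /= scaler0 !add0r normrN.
  exact: le_lt_trans tdz dze.
Unshelve. all: by end_near. Qed.

Lemma admissible_edom {W z p dz} : admissible W z p dz ->
  (edom p.1 `&` edom p.2) dz.
Proof.
case=> _; apply; exists 1; first by rewrite /= in_itv /= lexx ler01.
by rewrite subrr scale0r add0r scale1r.
Qed.

Definition remainder f z p (dz : Z) : E := f (z + dz) - f z - pair_val p dz.

Lemma expansion_remainder {W f z p dz} {u : E} : admissible W z p dz ->
  (f (z + dz) - f z)%:E = (p.1 dz + p.2 dz + u%:E)%E <-> u = remainder f z p dz.
Proof.
move=> /admissible_edom/edom_sumE ->; rewrite /remainder; split=> [[->]|->].
  by rewrite addrAC subrr add0r.
by congr (_%:E); rewrite addrC subrK.
Qed.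

(** At an admissible increment the equation leaves no choice for [o], and all small increments are
    admissible; [remainder] can therefore replace the existential function. *)
Lemma weak_expansionP K W f z p : open W -> W z ->
  weak_expansion K W f z p <->
  [/\ PF K p, pair_val p 0 = 0 & weak_o (remainder f z p)].
Proof.
move=> oW Wz; split=> -[Pp p0 ho]; (split=> //;
  first by apply/(PF_sum_eq0 _ _ Pp)).
  case: ho => o ho dz.
  have adz := near_scale_right dz _ (near_admissible oW Wz Pp).
  (* [o] is controlled only along admissible increments, so the limit along
     [dz] is obtained from the one along a small multiple [t *: dz]. *)
  have [t [t0 adt]] : exists t : R, 0 < t /\ admissible W z p (t *: dz).
    near (0 : R)^'+ => t; exists t; split=> //; exact: (near adz t).
  have [_ olim] := ho _ adt.
  (* Replacing [a] by [t^-1 * a] preserves the right-hand limit at 0; the factor [t] that it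
     produces is cancelled by scaling with [t^-1]. *)
  have tinv : (fun a : R => t^-1 * a) @ 0^'+ --> (0 : R)^'+.
    move=> A A0; have /(near_scale_right (t^-1 : R)) :
      \forall u \near (0 : R), 0 < u -> A u by exact: A0.
    apply: filterS2 (nbhs_right_gt 0) => a a0; rewrite /= mulrC; apply.
    by rewrite divr_gt0.
  rewrite -(scaler0 E t^-1).
  apply: cvg_trans (cvgZl_tmp (cvg_comp _ _ tinv olim)); apply: near_eq_cvg.
  near=> a.
  have tn0 := lt0r_neq0 t0.
  have tK : (t^-1 * a) *: (t *: dz) = a *: dz.
    by rewrite scalerA mulrAC mulVf// mul1r.
  rewrite /= tK scalerA invfM invrK mulKf//.
  congr (_ *: _).
  have aadz : admissible W z p (a *: dz) by near: a.
  by apply/(expansion_remainder aadz); apply: (ho _ _).1.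
exists (remainder f z p) => dz adz; split; last exact: ho.
exact/(expansion_remainder adz).
Unshelve. all: by end_near. Qed.

Lemma strong_expansionP K W f z p : open W -> W z ->
  strong_expansion K W f z p <->
  [/\ PF K p, pair_val p 0 = 0 & strong_o (remainder f z p)].
Proof.
move=> oW Wz; split=> -[Pp p0 ho]; (split=> //;
  first by apply/(PF_sum_eq0 _ _ Pp)).
  case: ho => o [oE olim].
  apply: cvg_trans olim; apply: near_eq_cvg; near=> dz; congr (_ *: _).
  have adz : admissible W z p dz.
    by near: dz; apply: nbhs_dnbhs; exact: (near_admissible oW Wz Pp).
  by apply/(expansion_remainder adz); exact: oE.
exists (remainder f z p); split=> // dz adz.
exact/(expansion_remainder adz).
Unshelve. all: by end_near. Qed.


(** * Equivalence of pairs and uniqueness of the derivatives *)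

Lemma sigma_w_sym K p q : PF K p -> PF K q -> sigma_w p q -> sigma_w q p.
Proof.
move=> Pp Pq /(sigma_wP _ _ _ Pp Pq)[pq0 pqo]; apply/(sigma_wP _ _ _ Pq Pp).
split=> //; have := weak_oN _ pqo.
by under eq_fun do rewrite opprB.
Qed.

Lemma sigma_s_sym K p q : PF K p -> PF K q -> sigma_s p q -> sigma_s q p.
Proof.
move=> Pp Pq /(sigma_sP _ _ _ Pp Pq)[pq0 pqo]; apply/(sigma_sP _ _ _ Pq Pp).
split=> //; have := strong_oN _ pqo.
by under eq_fun do rewrite opprB.
Qed.

Lemma sigma_w_trans K p q r : PF K p -> PF K q -> PF K r ->
  sigma_w p q -> sigma_w q r -> sigma_w p r.
Proof.
move=> Pp Pq Pr /(sigma_wP _ _ _ Pp Pq)[pq0 pqo].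
move=> /(sigma_w_sym _ _ _ Pq Pr)/(sigma_wP _ _ _ Pr Pq)[rq0 rqo].
apply/(sigma_wP _ _ _ Pp Pr); split; first by rewrite pq0.
have := weak_oB _ _ pqo rqo.
by under eq_fun do rewrite opprB addrA subrK.
Qed.

Lemma sigma_s_trans K p q r : PF K p -> PF K q -> PF K r ->
  sigma_s p q -> sigma_s q r -> sigma_s p r.
Proof.
move=> Pp Pq Pr /(sigma_sP _ _ _ Pp Pq)[pq0 pqo].
move=> /(sigma_s_sym _ _ _ Pq Pr)/(sigma_sP _ _ _ Pr Pq)[rq0 rqo].
apply/(sigma_sP _ _ _ Pp Pr); split; first by rewrite pq0.
have := strong_oB _ _ pqo rqo.
by under eq_fun do rewrite opprB addrA subrK.
Qed.

Lemma class_w_eq K p q : PF K p -> PF K q -> sigma_w p q ->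
  class_w K p = class_w K q.
Proof.
move=> Pp Pq pq; apply/seteqP; split=> r [_ Pr pr]; split=> //.
- exact: sigma_w_trans Pq Pp Pr (sigma_w_sym _ _ _ Pp Pq pq) pr.
- exact: sigma_w_trans Pp Pq Pr pq pr.
Qed.

Lemma class_s_eq K p q : PF K p -> PF K q -> sigma_s p q ->
  class_s K p = class_s K q.
Proof.
move=> Pp Pq pq; apply/seteqP; split=> r [_ Pr pr]; split=> //.
- exact: sigma_s_trans Pq Pp Pr (sigma_s_sym _ _ _ Pp Pq pq) pr.
- exact: sigma_s_trans Pp Pq Pr pq pr.
Qed.

(** Two expansions share the increment of [f], so their [pair_val] differ by a difference of
    remainders, which is little-o. Hence the set described by [get] is a singleton. *)
Lemma weak_derivativeE K W f z p : open W -> W z -> weak_expansion K W f z p ->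
  weak_derivative K W f z = class_w K p.
Proof.
move=> oW Wz wp; rewrite /weak_derivative; apply: get_unique.
  by exists p.
move=> _ [q wq ->]; move: wp wq.
move=> /(weak_expansionP _ _ _ _ _ oW Wz)[Pp p0 po].
move=> /(weak_expansionP _ _ _ _ _ oW Wz)[Pq q0 qo].
apply: class_w_eq => //; apply/(sigma_wP _ _ _ Pq Pp).
split; first by rewrite q0.
have := weak_oB _ _ po qo.
by under eq_fun do rewrite /remainder opprB addrC addrA subrK.
Qed.

Lemma strong_derivativeE K W f z p : open W -> W z ->
  strong_expansion K W f z p -> strong_derivative K W f z = class_s K p.
Proof.
move=> oW Wz wp; rewrite /strong_derivative; apply: get_unique.
  by exists p.
move=> _ [q wq ->]; move: wp wq.
move=> /(strong_expansionP _ _ _ _ _ oW Wz)[Pp p0 po].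
move=> /(strong_expansionP _ _ _ _ _ oW Wz)[Pq q0 qo].
apply: class_s_eq => //; apply/(sigma_sP _ _ _ Pq Pp).
split; first by rewrite q0.
have := strong_oB _ _ po qo.
by under eq_fun do rewrite /remainder opprB addrC addrA subrK.
Qed.

(** Equivalent pairs have remainders that differ by a little-o, so the expansion passes from one
    member of the class to all others. *)
Lemma strong_derivative_expansion K W f z p : open W -> W z ->
  strongly_codifferentiable K W f z ->
  strong_derivative K W f z p <-> strong_expansion K W f z p.
Proof.
move=> oW Wz [q sq]; split=> [|sp]; last first.
  rewrite (strong_derivativeE _ _ _ _ _ oW Wz sp).
  have [Pp _ _] := sp; split=> //; apply/(sigma_sP _ _ _ Pp Pp); split=> //.
  rewrite /strong_o; under eq_fun do rewrite subrr scaler0.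
  exact: cvg_cst.
rewrite (strong_derivativeE _ _ _ _ _ oW Wz sq).
move=> [Pq Pp] /(sigma_sP _ _ _ Pq Pp)[qp0 qpo]; apply/strong_expansionP => //.
move: sq => /(strong_expansionP _ _ _ _ _ oW Wz)[_ q0 qo].
split=> //; first by rewrite -qp0.
rewrite (_ : remainder f z p = fun dz =>
    remainder f z q dz - - (pair_val q dz - pair_val p dz)); last first.
  by apply/funext => dz; rewrite /remainder opprK addrA subrK.
exact: strong_oB _ _ qo (strong_oN _ qpo).
Qed.

(** * Codifferentials as classes of generating sets *)

Lemma class_w_refl K p : PF K p -> class_w K p p.
Proof.
move=> Pp; split=> //; apply/(sigma_wP _ _ _ Pp Pp); split=> // z.
by under eq_fun do rewrite subrr scaler0; exact: cvg_cst.
Qed.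

Lemma strong_codifferential_derivative K W f z U V : open W -> W z ->
  strongly_codifferentiable K W f z -> strong_codifferential K W f z (U, V) ->
  PFgen K (U, V) /\ strong_derivative K W f z (psup U, pinf V).
Proof.
move=> oW Wz sf; rewrite /strong_codifferential; set A := (X in get X).
(* The value of [get] is known to lie in [A] only once [A] is inhabited; sets generating a strong
   expansion give an element. *)
have /getPex : exists D, A D.
  have [p sp] := sf; have [[[U0 gU] [V0 gV] _] _ _] := sp.
  exists (gen_class_s K (U0, V0)), p, (U0, V0); split=> //.
  exact/strong_derivative_expansion.
set D := get A => -[p [P [dp [_ _ pU] [_ _ pV] ->]]] [PP PUV sUV].
split=> //; have [_ _ _ _ PF_UV] := PUV; have [_ _ _ _ PF_P] := PP.
have dP : strong_derivative K W f z (generated_pair P).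
  by rewrite /generated_pair -pU -pV -surjective_pairing.
move/(strong_derivative_expansion _ _ _ _ _ oW Wz sf) : dP.
by move=> /(strong_derivativeE _ _ _ _ _ oW Wz) ->.
Qed.

(** Any sets [Q] allowed by the description generate a pair in the class of [generated_pair P], so
    by transitivity [P] and [Q] have the same class. *)
Lemma weak_codifferentialE K W f z P : open W -> W z -> PFgen K P ->
  weak_expansion K W f z (generated_pair P) ->
  weak_codifferential K W f z = gen_class_w K P.
Proof.
move=> oW Wz PP /(weak_derivativeE _ _ _ _ _ oW Wz) dE.
have [U0 UK V0 VK PF_P] := PP.
rewrite /weak_codifferential dE; apply: get_unique.
  by exists (generated_pair P), P; split=> //; exact: class_w_refl.
move=> _ [p [Q [dp [Q10 Q1K pQ1] [Q20 Q2K pQ2] ->]]].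
have {pQ1 pQ2} pQ : p = generated_pair Q.
  by rewrite /generated_pair -pQ1 -pQ2 -surjective_pairing.
have {dp} [_ PF_Q PQ] : class_w K (generated_pair P) (generated_pair Q).
  by rewrite -pQ.
have QQ : PFgen K Q by split.
have QP := sigma_w_sym _ _ _ PF_P PF_Q PQ.
apply/seteqP; split=> -T [_ QT sT]; split=> //; have [_ _ _ _ PF_T] := QT.
- exact: sigma_w_trans PF_P PF_Q PF_T PQ sT.
- exact: sigma_w_trans PF_Q PF_P PF_T QP sT.
Qed.

Lemma pair_val_lipschitz p : lipschitz_near0 p.1 -> lipschitz_near0 p.2 ->
  exists (k : R) (N : set Z), nbhs 0 N /\
    forall u v, N u -> N v -> `|pair_val p u - pair_val p v| <= k * `|u - v|.
Proof.
move=> [k [M [nM _ kM]]] [l [N [nN _ lN]]].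
exists (k + l), (M `&` N); split=> [|u v [Mu Nu] [Mv Nv]]; first exact: filterI.
rewrite /pair_val opprD addrACA mulrDl (le_trans (ler_normD _ _))// lerD//.
- exact: (kM (u, v)).
- exact: (lN (u, v)).
Qed.

End Codifferentiability.

(** * Precomposition with a linear map and the chain rule *)

Section Composition.
Context {R : realType} {X Y : normedModType R} {E : normedLatticeType R}.
Implicit Types (H U V : set (X -> \bar E)) (F : X -> E) (G : Y -> X).
Implicit Types (p : (X -> \bar E) * (X -> \bar E)) (dG : {linear Y -> X}).

Definition precomp_pair p (L : Y -> X) := (p.1 \o L, p.2 \o L).

Lemma psup_precomp U (L : Y -> X) : psup (precomp_set U L) = psup U \o L.
Proof. by apply/funext => y; rewrite /psup /precomp_set image_comp. Qed.

Lemma pinf_precomp V (L : Y -> X) : pinf (precomp_set V L) = pinf V \o L.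
Proof. by apply/funext => y; rewrite /pinf /precomp_set image_comp. Qed.

Lemma generated_sup_precomp H U Phi (L : Y -> X) : generated_sup H U Phi ->
  generated_sup (precomp_set H L) (precomp_set U L) (Phi \o L).
Proof.
move=> [U0 UH ->]; split; [exact: image_nonempty|exact: image_subset|].
by rewrite psup_precomp.
Qed.

Lemma generated_inf_precomp H V Psi (L : Y -> X) : generated_inf H V Psi ->
  generated_inf (precomp_set H L) (precomp_set V L) (Psi \o L).
Proof.
move=> [V0 VH ->]; split; [exact: image_nonempty|exact: image_subset|].
by rewrite pinf_precomp.
Qed.

(** A bounded linear map is continuous and fixes the origin, so it pulls the neighbourhood of 0
    where the pair is finite back to a neighbourhood of 0. *)
Lemma PF_precomp H p dG : bounded_near dG (nbhs 0) -> PF H p ->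
  PF (precomp_set H dG) (precomp_pair p dG).
Proof.
move=> bdG [[U gU] [V gV] n0]; split.
- by exists (precomp_set U dG); exact: generated_sup_precomp.
- by exists (precomp_set V dG); exact: generated_inf_precomp.
- have /(_ 0) := bounded_linear_continuous bdG.
  by rewrite /continuous_at linear0 => /(_ _ n0).
Qed.

Lemma gateaux_increment G y dG h : is_gateaux_derivative G y dG ->
  (fun a : R => a^-1 *: (G (y + a *: h) - G y)) @ 0^'+ --> dG h.
Proof.
move=> [_ /(_ h)[dGh <-]].
apply: cvg_trans (cvg_dnbhs_at_right dGh); apply: near_eq_cvg.
by apply: nearW => a; rewrite [y + _]addrC.
Qed.

Lemma weak_o_remainder_comp F x p G y dG :
  strong_o (remainder F x p) -> pair_val p 0 = 0 ->
  lipschitz_near0 p.1 -> lipschitz_near0 p.2 ->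
  is_gateaux_derivative G y dG -> G y = x ->
  weak_o (remainder (F \o G) y (precomp_pair p dG)).
Proof.
move=> Fo p0 lp1 lp2 gG Gy h.
have [l [N [nN lN]]] := pair_val_lipschitz _ lp1 lp2.
pose k (a : R) := G (y + a *: h) - x.
have kv : (fun a : R => a^-1 *: k a) @ 0^'+ --> dG h.
  by rewrite /k -Gy; exact: gateaux_increment.
have rk := strong_o_curve _ k _ Fo _ kv.
have {}rk : (fun a : R => a^-1 *: remainder F x p (k a)) @ 0^'+ --> (0 : E).
  by apply: rk; rewrite /remainder addr0 subrr p0 subr0.
have k0 := rate_cvg0 _ _ kv.
have lk : (fun a : R => a^-1 *: (pair_val p (k a) - pair_val p (a *: dG h)))
    @ 0^'+ --> (0 : E).
  apply: norm_cvg0.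
  (* Once [k a] and [a *: dG h] lie in [N], the Lipschitz bound divided by [a] is [l] times the
     distance from the rate of [k] to its limit. *)
  apply: (@squeeze_cvgr _ _ _ _ (fun=> 0) (fun a => l * `|a^-1 *: k a - dG h|)).
  - near=> a.
    have a0 : 0 < a by [].
    rewrite normr_ge0 /= normrZ gtr0_norm ?invr_gt0//.
    have -> : a^-1 *: k a - dG h = a^-1 *: (k a - a *: dG h).
      by rewrite [RHS]scalerBr scalerA mulVf ?scale1r// lt0r_neq0.
    rewrite normrZ gtr0_norm ?invr_gt0// mulrCA ler_pM2l ?invr_gt0//.
    apply: lN; near: a; first exact: k0.
    exact: cvg_scale_right.
  - exact: cvg_cst.
  - have := cvgM (cvg_cst l) (cvg_norm (cvgB kv (cvg_cst (dG h)))).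
    rewrite subrr normr0 mulr0. exact.
(* The terms [pair_val p (k a)] cancel in the sum of the two limits, which leaves the remainder of
   the composite. *)
rewrite -(addr0 (0 : E)); apply: cvg_trans (cvgD rk lk); apply: near_eq_cvg.
apply: nearW => a; rewrite /= fctE -scalerDr; congr (_ *: _).
rewrite /remainder /k /= Gy [x + _]addrC subrK addrA subrK.
by rewrite /pair_val /= linearZ.
Unshelve. all: by end_near. Qed.

Lemma chain_rule_expansion H Omega F x p O G y dG :
  open Omega -> Omega x -> strongly_codifferentiable H Omega F x ->
  class_lipschitz_near0 (strong_derivative H Omega F x) ->
  strong_derivative H Omega F x p -> open O -> O y ->
  is_gateaux_derivative G y dG -> G y = x ->
  weak_expansion (precomp_set H dG) O (F \o G) y (precomp_pair p dG).
Proof.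
move=> oOm Omx sF [q [dq lq1 lq2]] dp oO Oy gG Gy.
move: dp dq => /(strong_derivative_expansion _ _ _ _ _ oOm Omx sF).
move=> /(strong_expansionP _ _ _ _ _ oOm Omx)[Pp p0 po].
move=> /(strong_derivative_expansion _ _ _ _ _ oOm Omx sF).
move=> /(strong_expansionP _ _ _ _ _ oOm Omx)[Pq q0 qo].
apply/weak_expansionP => //; have [bdG _] := gG; split.
- exact: PF_precomp.
- by rewrite /pair_val /= linear0.
(* The increment of [F] cancels here, so this compares [p] with [q]; both remainders vanish at 0, as
   [strong_o_weak] requires. *)
have qpo : weak_o (fun v => remainder F x q v - remainder F x p v).
  apply: strong_o_weak; first exact: strong_oB.
  by rewrite /remainder p0 q0 subrr.
have {}qpo : weak_o (fun h => pair_val p (dG h) - pair_val q (dG h)).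
  move=> h; apply: cvg_trans (qpo (dG h)).
  apply: near_eq_cvg; apply: nearW => a.
  by rewrite linearZ /remainder opprB addrC addrA subrK.
(* [p] itself need not be Lipschitz: the expansion is first obtained for [q],
   then transferred to [p]. *)
have To := weak_o_remainder_comp _ _ _ _ _ _ qo q0 lq1 lq2 gG Gy.
rewrite (_ : remainder (F \o G) y _ = fun h =>
    remainder (F \o G) y (precomp_pair q dG) h
    - (pair_val p (dG h) - pair_val q (dG h))); first exact: weak_oB.
by apply/funext => h; rewrite /remainder opprB addrA subrK.
Qed.

End Composition.

Theorem theorem4p5 (R : realType) (X Y : normedModType R)
    (E : normedLatticeType R) (Omega : set X) (H : set (X -> \bar E))
    (F : X -> E) (x : X) (S : set Y) (y : Y) (G : Y -> X)
    (dG : {linear Y -> X}) :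
  order_complete E ->
  open Omega ->
  H !=set0 ->
  Omega x ->
  strongly_codifferentiable H Omega F x ->
  class_lipschitz_near0 (strong_derivative H Omega F x) ->
  open S ->
  S y ->
  {for y, continuous G} ->
  is_gateaux_derivative G y dG ->
  G y = x ->
  exists O : set Y,
    [/\ open O, O `<=` S, O y, G @` O `<=` Omega &
        weakly_codifferentiable (precomp_set H dG) O (F \o G) y] /\
    (forall Phi Psi : X -> \bar E,
       strong_derivative H Omega F x (Phi, Psi) ->
       weak_derivative (precomp_set H dG) O (F \o G) y
       = class_w (precomp_set H dG) (Phi \o dG, Psi \o dG)) /\
    (forall U V : set (X -> \bar E),
       strong_codifferential H Omega F x (U, V) ->
       weak_codifferential (precomp_set H dG) O (F \o G) y
       = gen_class_w (precomp_set H dG) (precomp_set U dG, precomp_set V dG)).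
Proof.
move=> _ oOm _ Omx sF lF oS Sy cG gG Gy.
(* Continuity of [G] at [y] makes this intersection a neighbourhood of [y]; taking the interior
   makes it open. *)
pose O := (S `&` G @^-1` Omega)^°.
have oO : open O by exact: open_interior.
have OSG : O `<=` S `&` G @^-1` Omega by exact: interior_subset.
have Oy : O y.
  apply: filterI; first exact: open_nbhs_nbhs.
  by apply: cG; rewrite Gy; exact: open_nbhs_nbhs.
have chain p (dp : strong_derivative H Omega F x p) :=
  chain_rule_expansion _ _ _ _ _ _ _ _ _ oOm Omx sF lF dp oO Oy gG Gy.
exists O; split; [split=> //|split].
- by move=> z /OSG[].
- by move=> _ [z /OSG[_ ?] <-].
- by have [p [/chain dp _ _]] := lF; exists (precomp_pair p dG).
- by move=> Phi Psi /chain/(weak_derivativeE _ _ _ _ _ oO Oy).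
- move=> U V /(strong_codifferential_derivative _ _ _ _ _ _ oOm Omx sF).
  move=> [[U0 UH V0 VH [_ _ n0]] /chain TUV].
  (* Suprema and infima are pointwise, so the composed sets generate the composed pair, to which the
     chain rule applies. *)
  have gTUV : generated_pair (precomp_set U dG, precomp_set V dG)
      = precomp_pair (psup U, pinf V) dG.
    by rewrite /generated_pair /= psup_precomp pinf_precomp.
  apply: weak_codifferentialE => //; rewrite ?gTUV//.
  have [PT _ _] := TUV; split; rewrite ?gTUV//=;
    by [exact: image_nonempty|exact: image_subset].
Qed.
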